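(* Let $k$ be a subfield of $\mathbb{C}$, and $q>1$ an integer. Let $V$ be a graded $\text{FI}_{\mathcal{W}}$--module over $k$ supported in positive grades containing a free $\text{FI}_{\mathcal{W}}$--module on a representation of $\mathcal{W}_2$. Let $A^*$ be an $\text{FI}_{\mathcal{W}}$--algebra containing the free symmetric algebra on $V$. Then there exist character polynomials $P$ for which the following series does not converge: $$ \sum_{d=0} \frac{ \lim_{n \to \infty} \langle P_n, A^d_n \rangle_{\mathcal{W}_n}}{q^d}. $$
   Context: $\mathcal{W}_n$ denotes either the symmetric groups $S_n$ or the hyperoctahedral (signed permutation) groups $B_n$. The category $\text{FI}_{\mathcal{W}}$ has objects $\mathbf{n}=\{1,\bar 1,\dots,n,\bar n\}$ and morphisms generated by $\mathcal{W}_n=\mathrm{End}(\mathbf n)$ and the standard inclusions $\mathbf n\to\mathbf{n+1}$; an $\text{FI}_{\mathcal{W}}$--module (resp. graded $\text{FI}_{\mathcal{W}}$--algebra) is a functor from $\text{FI}_{\mathcal{W}}$ to modules (resp. graded algebras), with $A^d_n$ the degree-$d$ piece at $\mathbf n$. For a $\mathcal{W}_m$-representation $U$ the free $\text{FI}_{\mathcal{W}}$--module on $U$ is $M_{\mathcal W}(U)=k[\mathrm{Hom}_{\text{FI}_{\mathcal W}}(\mathbf m,-)]\otimes_{k[\mathcal W_m]}U$, with $M_{\mathcal W}(U)_n\cong \mathrm{Ind}_{\mathcal W_m\times\mathcal W_{n-m}}^{\mathcal W_n}U\boxtimes k$. A character polynomial is a polynomial in the class functions $X_r$ (number of $r$-cycles)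 for $S_n$, or in $X_r,Y_r$ (numbers of positive/negative $r$-cycles) for $B_n$; $P_n$ is its restriction to $\mathcal W_n$ and $\langle-,-\rangle_{\mathcal W_n}$ the standard inner product of class functions. *)

(* Defs.v *)
From HB Require Import structures.
From mathcomp Require Import all_boot all_order all_algebra complex.
From mathcomp Require mpoly.

Set Implicit Arguments.
Unset Strict Implicit.
Unset Printing Implicit Defensive.

Import GRing.Theory.

(* TypeA : W_n = S_n; TypeB : W_n = B_n, the signed permutations. *)
Variant wtype := TypeA | TypeB.

(* The object n = {1, \bar 1, ..., n, \bar n}: (i, false) is the letter i + 1
   and (i, true) is \bar{i + 1}. *)
Definition pt (n : nat) : finType := ('I_n * bool)%type.

Definition bar n (x : pt n) : pt n := (x.1, ~~ x.2).

Definition is_hom (W : wtype) m n (f : {ffun pt m -> pt n}) : bool :=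
  [&& injectiveb f, [forall x, f (bar x) == bar (f x)] &
      if W is TypeA then [forall x, (f x).2 == x.2] else true].

(* Hom_{FI_W}(m, n); the group W_n is the endomorphism monoid hom W n n.
   homs_generated below shows that these maps are exactly the ones generated by
   the groups W_n and the standard inclusions. *)
Record hom (W : wtype) (m n : nat) : predArgType :=
  Hom { hom_val :> {ffun pt m -> pt n}; homP : is_hom W hom_val }.

HB.instance Definition _ W m n := [isSub for @hom_val W m n].
HB.instance Definition _ W m n := [Finite of hom W m n by <:].

Definition ffcomp m n p (g : {ffun pt n -> pt p}) (f : {ffun pt m -> pt n}) :
  {ffun pt m -> pt p} := [ffun x => g (f x)].

Lemma is_hom_id W n : is_hom W [ffun x : pt n => x].
Proof.
apply/and3P; split.
- by apply/injectiveP => x y; rewrite !ffunE.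
- by apply/forallP => x; rewrite !ffunE.
- by case: W => //; apply/forallP => x; rewrite ffunE.
Qed.

Lemma is_hom_comp W m n p (g : {ffun pt n -> pt p}) (f : {ffun pt m -> pt n}) :
  is_hom W g -> is_hom W f -> is_hom W (ffcomp g f).
Proof.
case/and3P => /injectiveP gi /forallP gb gs /and3P[/injectiveP fi /forallP fb fs].
apply/and3P; split.
- by apply/injectiveP => x y; rewrite !ffunE => /gi /fi.
- by apply/forallP => x; rewrite !ffunE (eqP (fb x)) (eqP (gb _)).
- case: W gs fs => // /forallP gs /forallP fs.
  by apply/forallP => x; rewrite ffunE (eqP (gs _)) (eqP (fs _)).
Qed.

Definition idh W n : hom W n n := Hom (is_hom_id W n).

Definition comph W m n p (g : hom W n p) (f : hom W m n) : hom W m p :=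
  Hom (is_hom_comp (homP g) (homP f)).

Definition std_incl n : {ffun pt n -> pt n.+1} :=
  [ffun x => (widen_ord (leqnSn n) x.1, x.2)].

Inductive generated (W : wtype) : forall m n, {ffun pt m -> pt n} -> Prop :=
| gen_W n (w : {ffun pt n -> pt n}) : is_hom W w -> generated W w
| gen_incl n : generated W (std_incl n)
| gen_comp m n p (g : {ffun pt n -> pt p}) (f : {ffun pt m -> pt n}) :
    generated W g -> generated W f -> generated W (ffcomp g f).

Lemma is_hom_incl W n : is_hom W (std_incl n).
Proof.
apply/and3P; split.
- apply/injectiveP => -[x b] [y c]; rewrite !ffunE /= => -[exy ->].
  by congr (_, _); apply: val_inj.
- by apply/forallP => x; rewrite !ffunE.
- by case: W => //; apply/forallP => x; rewrite ffunE.
Qed.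

Definition widen_pt m n (le_mn : m <= n) : {ffun pt m -> pt n} :=
  [ffun x => (widen_ord le_mn x.1, x.2)].

Lemma generated_widen W m n (le_mn : m <= n) : generated W (widen_pt le_mn).
Proof.
elim: n le_mn => [|n IHn] le_mn.
  have m0 : m = 0 by apply/eqP; rewrite -leqn0.
  subst m; apply: gen_W; have -> : widen_pt le_mn = [ffun x => x].
    by apply/ffunP => -[[]].
  exact: is_hom_id.
have [le_mn'|lt_nm] := leqP m n.
  have -> : widen_pt le_mn = ffcomp (std_incl n) (widen_pt le_mn').
    by apply/ffunP => x; rewrite !ffunE /=; congr (_, _); apply: val_inj.
  by apply: gen_comp; [apply: gen_incl | apply: IHn].
have mn : m = n.+1 by apply/eqP; rewrite eqn_leq le_mn.
subst m; have -> : widen_pt le_mn = [ffun x => x].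
  apply/ffunP => -[x b]; rewrite !ffunE /=; congr (_, _); exact: val_inj.
by apply: gen_W; apply: is_hom_id.
Qed.

Lemma homs_generated W m n (f : {ffun pt m -> pt n}) :
  is_hom W f <-> generated W f.
Proof.
split; last first.
  by elim=> *; [done | apply: is_hom_incl | apply: is_hom_comp].
case/and3P => /injectiveP fi /forallP fb fs.
have fbE x : f (bar x) = bar (f x) by apply/eqP/fb.
pose g (i : 'I_m) : 'I_n := (f (i, false)).1.
have gi : injective g.
  move=> i j; rewrite /g => gij.
  case: (eqVneq (f (i, false)).2 (f (j, false)).2) => [e2|n2].
    suff /fi [] : f (i, false) = f (j, false) by [].
    by case: (f (i, false)) (f (j, false)) gij e2 => ? ? [? ?] /= -> ->.
  suff /fi : f (i, false) = f (bar (j, false)) by [].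
  rewrite fbE /bar; case: (f (i, false)) (f (j, false)) gij n2 => a b [c d] /= ->.
  by case: b d => [] [].
pose s := codom g ++ enum [predC codom g].
have us : uniq s.
  rewrite cat_uniq enum_uniq andbT; apply/andP; split.
    by rewrite /codom /image_mem map_inj_uniq ?enum_uniq.
  by apply/hasPn => x; rewrite mem_enum.
have ss : size s = n.
  rewrite -(card_uniqP us) -[RHS]card_ord; apply: eq_card => x.
  by rewrite mem_cat mem_enum !inE orbN.
have le_mn : m <= n.
  by rewrite -[m in X in X <= _]card_ord -[n in X in _ <= X]card_ord; apply: (leq_card g).
pose sg (i : 'I_n) : bool :=
  if insub (val i) is Some j then (f (j : 'I_m, false)).2 else false.
pose w : {ffun pt n -> pt n} := [ffun x => (nth x.1 s x.1, x.2 (+) sg x.1)].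
have hw : is_hom W w.
  apply/and3P; split.
  - apply/injectiveP => -[x b] [y c]; rewrite !ffunE /= => -[exy].
    have exy' : x = y.
      apply/val_inj/eqP; rewrite -(nth_uniq x _ _ us) ?ss ?ltn_ord //.
      by rewrite exy (set_nth_default x) ?ss ?ltn_ord.
    by rewrite exy' => /addIb ->.
  - apply/forallP => -[x b]; rewrite !ffunE /bar /=; apply/eqP.
    by congr (_, _); rewrite addNb.
  - case: W fs => // /forallP fs; apply/forallP => -[x b]; rewrite ffunE /= /sg.
    by case: insub => [j|]; rewrite ?(eqP (fs _)) addbF.
have -> : f = ffcomp w (widen_pt le_mn).
  have key (i : 'I_m) : f (i, false) = (nth (widen_ord le_mn i) s i, sg (widen_ord le_mn i)).
    have -> : sg (widen_ord le_mn i) = (f (i, false)).2.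
      rewrite /sg /=; case: insubP => [j _ ej|]; last by rewrite ltn_ord.
      by rewrite (val_inj ej : j = i).
    rewrite /s nth_cat size_codom card_ord ltn_ord.
    rewrite /codom /image_mem (nth_map i) ?size_enum_ord // nth_ord_enum.
    by rewrite /g; case: (f _).
  apply/ffunP => -[i b]; rewrite !ffunE /=; case: b => /=; last by rewrite key.
  by rewrite (_ : (i, true) = bar (i, false)) // fbE key.
by apply: gen_comp; [apply: gen_W | apply: generated_widen].
Qed.

(* The cycles of w acting on {1, ..., n} once signs are forgotten. *)
Definition cycles W n (w : hom W n n) : {set {set 'I_n}} :=
  [set [set y.1 | y : pt n & fconnect w x y] | x : pt n].

(* A cycle is negative when w reverses an odd number of its signs. *)
Definition neg_cycle W n (w : hom W n n) (D : {set 'I_n}) : bool :=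
  odd #|[set i in D | (w (i, false)).2]|.

Definition Xcount W n (r : nat) (w : hom W n n) : nat :=
  #|[set D in cycles w | (#|D| == r) && ~~ neg_cycle w D]|.

Definition Ycount W n (r : nat) (w : hom W n n) : nat :=
  #|[set D in cycles w | (#|D| == r) && neg_cycle w D]|.

(* Variables of a character polynomial: X_1, ..., X_N for S_n, and
   X_1, ..., X_N, Y_1, ..., Y_N for B_n. *)
Definition cp_nvars (W : wtype) (N : nat) : nat :=
  if W is TypeA then N else N + N.

Definition cp_var (W : wtype) (N n : nat) :
    hom W n n -> 'I_(cp_nvars W N) -> nat :=
  match W return hom W n n -> 'I_(cp_nvars W N) -> nat with
  | TypeA => fun w i => Xcount i.+1 w
  | TypeB => fun w i => match split i with
                        | inl j => Xcount j.+1 w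
                        | inr j => Ycount j.+1 w
                        end
  end.

Local Open Scope ring_scope.

Record charpoly (k : fieldType) (W : wtype) := CharPoly {
  cp_bound : nat;
  cp_poly : mpoly.mpoly (cp_nvars W cp_bound) k }.

(* The class function P_n on W_n. *)
Definition cp_eval (k : fieldType) W (P : charpoly k W) n (w : hom W n n) : k :=
  mpoly.meval (fun i => (cp_var w i)%:R) (cp_poly P).

Record Wrep (k : fieldType) (W : wtype) (m : nat) := {
  wr_car :> lmodType k;
  wr_act : hom W m m -> {linear wr_car -> wr_car};
  wr_act1 : forall u, wr_act (idh W m) u = u;
  wr_actM : forall g h u, wr_act (comph g h) u = wr_act g (wr_act h u) }.

Record FIWmod (k : fieldType) (W : wtype) := {
  fm_car :> nat -> lmodType k;
  fm_map : forall m n, hom W m n -> {linear fm_car m -> fm_car n};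
  fm_map1 : forall n x, fm_map (idh W n) x = x;
  fm_mapM : forall m n p (g : hom W n p) (f : hom W m n) x,
    fm_map (comph g f) x = fm_map g (fm_map f x) }.

(* G exhibits T as the internal direct sum of the subspaces G d, d >= 0. *)
Record is_grading (k : fieldType) (T : lmodType k) (G : nat -> T -> Prop) :
    Prop := {
  gr0 : forall d, G d 0;
  grP : forall d a x y, G d x -> G d y -> G d (a *: x + y);
  gr_span : forall x, exists N (c : nat -> T),
    (forall d, G d (c d)) /\ x = \sum_(d < N) c d;
  gr_indep : forall N (c : nat -> T), (forall d, G d (c d)) ->
    \sum_(d < N) c d = 0 -> forall d, (d < N)%N -> c d = 0 }.

(* gm_gr V n d is V^d_n, a subspace of V_n. *)
Record gradedFIWmod (k : fieldType) (W : wtype) := {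
  gm_mod :> FIWmod k W;
  gm_gr : forall n, nat -> gm_mod n -> Prop;
  gm_grading : forall n, is_grading (@gm_gr n);
  gm_map_gr : forall m n (f : hom W m n) d x,
    gm_gr d x -> gm_gr d (fm_map gm_mod f x) }.

Record gradedFIWalg (k : fieldType) (W : wtype) := {
  ga_car :> nat -> algType k;
  ga_map : forall m n, hom W m n -> {lrmorphism ga_car m -> ga_car n};
  ga_map1 : forall n x, ga_map (idh W n) x = x;
  ga_mapM : forall m n p (g : hom W n p) (f : hom W m n) x,
    ga_map (comph g f) x = ga_map g (ga_map f x);
  ga_gr : forall n, nat -> ga_car n -> Prop;
  ga_grading : forall n, is_grading (@ga_gr n);
  ga_gr_one : forall n, ga_gr 0 (1 : ga_car n);
  ga_gr_mul : forall n d e (x y : ga_car n),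
    ga_gr d x -> ga_gr e y -> ga_gr (d + e)%N (x * y);
  ga_map_gr : forall m n (f : hom W m n) d x,
    ga_gr d x -> ga_gr d (ga_map f x) }.

Definition positively_graded (k : fieldType) W (V : gradedFIWmod k W) : Prop :=
  forall n (x : V n), gm_gr 0 x -> x = 0.

Definition balanced (k : fieldType) W m n (U : Wrep k W m) (T : lmodType k)
    (t : hom W m n -> {linear U -> T}) : Prop :=
  forall (f : hom W m n) (w : hom W m m) (u : U),
    t (comph f w) u = t f (wr_act U w u).

(* M is M_W(U) = k[Hom(m, -)] \otimes_{k[W_m]} U, where tau n f u is the tensor
   f \otimes u: each M_n has the universal property of that tensor product (a
   bilinear map on k[Hom(m, n)] x U is a family of linear maps on U indexed by
   Hom(m, n)), and FI_W acts by composition on the left factor. *)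
Record is_free_FIWmod (k : fieldType) W m (U : Wrep k W m) (M : FIWmod k W)
    (tau : forall n, hom W m n -> {linear U -> M n}) : Prop := {
  fr_balanced : forall n, balanced (@tau n);
  fr_map : forall n p (g : hom W n p) (f : hom W m n) u,
    fm_map M g (tau n f u) = tau p (comph g f) u;
  fr_univ : forall n (T : lmodType k) (t : hom W m n -> {linear U -> T}),
    balanced t ->
    exists h : {linear M n -> T},
      (forall f u, h (tau n f u) = t f u) /\
      (forall h' : {linear M n -> T},
         (forall f u, h' (tau n f u) = t f u) -> h' =1 h) }.

Definition FIWmod_contains (k : fieldType) W (V M : FIWmod k W) : Prop :=
  exists i : forall n, {linear M n -> V n},
    (forall m n (f : hom W m n) x, i n (fm_map M f x) = fm_map V f (i m x)) /\
    (forall n, injective (i n)).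

(* The representation is required to be nonzero. *)
Definition contains_free_on (k : fieldType) W (V : FIWmod k W) (m : nat) : Prop :=
  exists (U : Wrep k W m) (M : FIWmod k W)
         (tau : forall n, hom W m n -> {linear U -> M n}),
    [/\ exists u : U, u != 0, is_free_FIWmod tau & FIWmod_contains V M].

(* S is the free symmetric algebra on V, via j : V -> S: for each n, S_n is the
   free commutative algebra on the k-module V_n.  The grading and the FI_W-maps
   of S are then forced by those of V, since S_n is generated by j(V_n). *)
Record is_sym_alg (k : fieldType) W (V : gradedFIWmod k W)
    (S : gradedFIWalg k W) (j : forall n, {linear V n -> S n}) : Prop := {
  sym_comm : forall n (x y : S n), x * y = y * x;
  sym_map : forall m n (f : hom W m n) x,
    j n (fm_map V f x) = ga_map S f (j m x);
  sym_gr : forall n d (x : V n), gm_gr d x -> ga_gr d (j n x);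
  sym_univ : forall n (B : comAlgType k) (f : {linear V n -> B}),
    exists h : {lrmorphism S n -> B},
      (forall x, h (j n x) = f x) /\
      (forall h' : {lrmorphism S n -> B},
         (forall x, h' (j n x) = f x) -> h' =1 h) }.

Definition FIWalg_contains (k : fieldType) W (A S : gradedFIWalg k W) : Prop :=
  exists i : forall n, {lrmorphism S n -> A n},
    [/\ forall m n (f : hom W m n) x, i n (ga_map S f x) = ga_map A f (i m x),
        forall n d (x : S n), ga_gr d x -> ga_gr d (i n x)
      & forall n, injective (i n)].

Definition contains_sym_alg (k : fieldType) W (A : gradedFIWalg k W)
    (V : gradedFIWmod k W) : Prop :=
  exists (S : gradedFIWalg k W) (j : forall n, {linear V n -> S n}),
    is_sym_alg j /\ FIWalg_contains A S.

Definition is_basis (k : fieldType) (T : lmodType k) (G : T -> Prop) r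
    (b : 'I_r -> T) : Prop :=
  [/\ forall i, G (b i),
      forall c : 'I_r -> k, \sum_i c i *: b i = 0 -> forall i, c i = 0
    & forall x, G x -> exists c : 'I_r -> k, x = \sum_i c i *: b i].

Definition finite_dim (k : fieldType) (T : lmodType k) (G : T -> Prop) : Prop :=
  exists r (b : 'I_r -> T), is_basis G b.

Definition finite_type (k : fieldType) W (A : gradedFIWalg k W) : Prop :=
  forall n d, finite_dim (@ga_gr k W A n d).

From mathcomp Require Import boolp classical_sets reals topology normedtype sequences.
Import numFieldNormedType.Exports.

(* The trace of f on a finite-dimensional f-stable subspace G: the trace of the
   matrix of f in any basis of G. *)
Definition trace_on (k : fieldType) (T : lmodType k) (G : T -> Prop)
    (f : T -> T) : k :=
  xget 0 (fun t : k => exists r (b : 'I_r -> T) (M : 'M[k]_r),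
    [/\ is_basis G b, forall i, f (b i) = \sum_j M i j *: b j & t = \tr M]).

Definition alg_char (k : fieldType) W (A : gradedFIWalg k W) (n d : nat)
    (w : hom W n n) : k :=
  trace_on (@ga_gr k W A n d) (ga_map A w).

(* The field of complex numbers, over which convergence is stated; R is any
   model of the real numbers. *)
Definition Cplx (R : realType) : numClosedFieldType := R[i].

Definition inner_prod (R : realType) W n (phi psi : hom W n n -> Cplx R) :
  Cplx R := #|hom W n n|%:R^-1 * \sum_(w : hom W n n) phi w * (psi w)^*.

(* <P_n, A^d_n>_{W_n}, computed in C along the embedding iota of k. *)
Definition char_inner (R : realType) (k : fieldType)
    (iota : {rmorphism k -> Cplx R}) W (P : charpoly k W)
    (A : gradedFIWalg k W) (n d : nat) : Cplx R :=
  inner_prod (fun w : hom W n n => iota (cp_eval P w))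
             (fun w : hom W n n => iota (alg_char A d w)).

(* Main.v *)
(* Take P = 1, so that <P_n, A^d_n> is the dimension of the W_n-invariants of A^d_n
   and it suffices to find q^d independent invariants for arbitrarily large d and all
   large n.  A tensor id (x) u in the free submodule M_W(U) of V has a homogeneous
   component x, of some degree delta > 0, whose second differences never vanish;
   hence the translates h x, with h in Hom(2, n), sit in independent directions
   according to the edge {i, j} they lie over.  For a simple graph g on {1, ..., n}
   let x_g be the product of the h x over all h whose image is an edge of g.
   Multiplying over all such h makes x_g insensitive to the signs and to the structure
   of U, so W_n permutes the monomials x_g as it permutes graphs, and the orbit sums of
   pairwise non-isomorphic graphs are independent.  Graphs with m = 4s + 1 vertices and
   2m edges number at least s^(2m), and at most m^m of them are isomorphic to a given
   one, so there are at least (s / 5)^m classes, while d = 2m |W_2| delta: the count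
   exceeds q^d as soon as s >= 5 q^(2 |W_2| delta). *)

From HB Require Import structures.
From mathcomp Require Import all_boot all_order all_algebra complex.
From mathcomp Require mpoly.
From mathcomp Require Import zify.
Require Import Defs.

Set Implicit Arguments.
Unset Strict Implicit.
Unset Printing Implicit Defensive.

Import Order.TTheory GRing.Theory Num.Theory.

(** * Morphisms of FI_W *)

Section Homs.
Variable W : wtype.

Lemma hom_inj m n (f : hom W m n) : injective f.
Proof. by have /and3P[/injectiveP] := homP f. Qed.

Lemma hom_bar m n (f : hom W m n) x : f (bar x) = bar (f x).
Proof. by have /and3P[_ /forallP/(_ x)/eqP] := homP f. Qed.

(** By [homE] a morphism is an injection of letters with a sign change on each of them; [base_hom]
    is the converse construction. *)
Definition ubase m n (f : hom W m n) (i : 'I_m) : 'I_n := (f (i, false)).1.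
Definition usign m n (f : hom W m n) (i : 'I_m) : bool := (f (i, false)).2.

Lemma homE m n (f : hom W m n) x : f x = (ubase f x.1, x.2 (+) usign f x.1).
Proof.
case: x => i [] /=; last by rewrite /ubase /usign; case: (f _).
have -> : (i, true) = bar (i, false) by [].
by rewrite hom_bar /bar /ubase /usign; case: (f _).
Qed.

Lemma ubase_inj m n (f : hom W m n) : injective (ubase f).
Proof.
move=> i j e; suff : f (i, usign f i) = f (j, usign f j) by move/hom_inj => -[].
by rewrite !homE /= !addbb e.
Qed.

Lemma usignA m n (f : hom W m n) i : W = TypeA -> usign f i = false.
Proof.
have ifA V (b : bool) : V = TypeA -> (if V is TypeA then b else true) -> b.
  by move=> ->.
by move=> /ifA WA; have /and3P[_ _ /WA/forallP/(_ (i, false))/eqP] := homP f.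
Qed.

Lemma is_hom_base m n (g : 'I_m -> 'I_n) (s : 'I_m -> bool) :
    injective g -> (W = TypeA -> s =1 xpred0) ->
  is_hom W [ffun x : pt m => (g x.1, x.2 (+) s x.1)].
Proof.
move=> gi sA; apply/and3P; split.
- apply/injectiveP => -[i b] [j c]; rewrite !ffunE /= => -[/gi ->].
  by move/addIb ->.
- by apply/forallP => x; rewrite !ffunE /bar /= addNb.
- by case: W sA => // sA; apply/forallP => x; rewrite ffunE /= sA ?addbF.
Qed.

Definition base_hom m n (g : 'I_m -> 'I_n) s gi sA : hom W m n :=
  Hom (@is_hom_base m n g s gi sA).

Lemma base_homE m n (g : 'I_m -> 'I_n) s gi sA x :
  @base_hom m n g s gi sA x = (g x.1, x.2 (+) s x.1).
Proof. by rewrite ffunE. Qed.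

Lemma comphE m n p (g : hom W n p) (f : hom W m n) x : comph g f x = g (f x).
Proof. by rewrite ffunE. Qed.

Lemma idhE n x : idh W n x = x.
Proof. by rewrite ffunE. Qed.

Lemma hom_eqP m n (f g : hom W m n) : f =1 g -> f = g.
Proof. by move=> fg; apply/val_inj/ffunP. Qed.

Lemma comphA m n p r (h : hom W p r) (g : hom W n p) (f : hom W m n) :
  comph h (comph g f) = comph (comph h g) f.
Proof. by apply: hom_eqP => x; rewrite !comphE. Qed.

Lemma comph1 m n (f : hom W m n) : comph f (idh W m) = f.
Proof. by apply: hom_eqP => x; rewrite comphE idhE. Qed.

Lemma comp1h m n (f : hom W m n) : comph (idh W n) f = f.
Proof. by apply: hom_eqP => x; rewrite comphE idhE. Qed.

Lemma comph_injr m n p (g : hom W n p) : injective (@comph W m n p g).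
Proof.
move=> f1 f2 e; apply: hom_eqP => x; apply: (@hom_inj _ _ g).
by rewrite -!comphE e.
Qed.

Lemma comph_injl n p (w : hom W n n) : injective (fun f : hom W n p => comph f w).
Proof.
move=> f1 f2 e; apply: hom_eqP => x.
have [v _ wK] := injF_bij (@hom_inj _ _ w).
by rewrite -(wK x) -!comphE e.
Qed.

Lemma ubase_comp m n p (g : hom W n p) (f : hom W m n) i :
  ubase (comph g f) i = ubase g (ubase f i).
Proof. by rewrite /ubase comphE homE. Qed.

Definition img m n (f : hom W m n) : {set 'I_n} := [set ubase f i | i : 'I_m].

Lemma img_comp m n p (g : hom W n p) (f : hom W m n) :
  img (comph g f) = ubase g @: img f.
Proof.
rewrite /img -imset_comp; apply: eq_imset => i /=; exact: ubase_comp.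
Qed.

Lemma card_img m n (f : hom W m n) : #|img f| = m.
Proof. by rewrite card_imset ?card_ord //; apply: ubase_inj. Qed.

(** Each [ubase f i] equals some [ubase g (b i)]. The injection [b] of m letters into themselves,
    signed by the sum of the signs of f and g, is the required w. *)
Lemma hom_factor m n (f g : hom W m n) :
  img f \subset img g -> exists w : hom W m m, f = comph g w.
Proof.
move=> /subsetP fg.
have ex (i : 'I_m) : exists j : 'I_m, ubase f i == ubase g j.
  have /fg/imsetP[j _ e] : ubase f i \in img f by apply: imset_f.
  by exists j; apply/eqP.
pose b i := xchoose (ex i).
have bE i : ubase f i = ubase g (b i) by apply/eqP/(xchooseP (ex i)).
have bi : injective b.
  by move=> i j e; apply: (@ubase_inj _ _ f); rewrite !bE e.
have sA : W = TypeA -> (fun i => usign f i (+) usign g (b i)) =1 xpred0.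
  by move=> WA i; rewrite !usignA.
exists (base_hom bi sA); apply: hom_eqP => x.
rewrite comphE base_homE [in RHS]homE /= -bE -!addbA addbb addbF.
exact: homE.
Qed.

Lemma hom_invertible n (w : hom W n n) :
  exists2 v : hom W n n, comph w v = idh W n & comph v w = idh W n.
Proof.
have [|v e] := @hom_factor n n (idh W n) w.
  suff -> : img w = [set: 'I_n] by apply: subsetT.
  by apply/eqP; rewrite eqEcard subsetT cardsT card_ord card_img leqnn.
exists v => //; apply: (@comph_injr n n n w).
by rewrite comphA -e comp1h comph1.
Qed.

(** Precomposition makes the maps onto E a torsor under W_m; [f0], which enumerates E, is a base
    point. *)
Lemma card_hom_img m n (E : {set 'I_n}) : #|E| = m ->
  #|[set f : hom W m n | img f == E]| = #|hom W m m|.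
Proof.
move=> cE.
have gi : injective (fun i : 'I_m => enum_val (cast_ord (esym cE) i)).
  by move=> i j /enum_val_inj/cast_ord_inj.
pose f0 : hom W m n := base_hom gi (fun _ _ => erefl).
have f0E i : ubase f0 i = enum_val (cast_ord (esym cE) i) by rewrite /ubase base_homE.
have imf0 : img f0 = E.
  apply/eqP; rewrite eqEcard card_img cE leqnn andbT.
  by apply/subsetP => _ /imsetP[i _ ->]; rewrite f0E enum_valP.
rewrite -cardsT -(card_imset _ (@comph_injr m m n f0)); apply: eq_card => f.
rewrite inE; apply/eqP/imsetP => [fE|[w _ ->]].
  by have [|w ->] := @hom_factor m n f f0; [rewrite fE imf0 | exists w].
apply/eqP; rewrite eqEcard card_img cE leqnn andbT img_comp.
by apply/subsetP => _ /imsetP[i _ ->]; rewrite -imf0; apply: imset_f.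
Qed.

(** Up to a standard inclusion every morphism can be undone: g sends the letters of f back to the
    first m letters, cancelling their signs, and puts all other letters beyond them. *)
Lemma hom_retract m n (f : hom W m n) :
  exists g : hom W n (m + n),
    forall x, comph g f x = (lshift n x.1, x.2).
Proof.
pose gb (y : 'I_n) : 'I_(m + n) :=
  if [pick i | ubase f i == y] is Some i then lshift n i else rshift m y.
pose gs (y : 'I_n) : bool :=
  if [pick i | ubase f i == y] is Some i then usign f i else false.
have gi : injective gb.
  move=> x y; rewrite /gb; case: pickP => [i /eqP <-|_]; case: pickP => [j /eqP <-|_].
  - by move/lshift_inj ->.
  - by move/eqP; rewrite eq_lrshift.
  - by move/eqP; rewrite eq_rlshift.
  - by move/rshift_inj.
have sA : W = TypeA -> gs =1 xpred0.
  by move=> WA y; rewrite /gs; case: pickP => // i _; rewrite usignA.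
exists (base_hom gi sA) => x; rewrite comphE base_homE homE /gb /gs /=.
case: pickP => [i /eqP/ubase_inj ->|/(_ x.1)]; last by rewrite eqxx.
by rewrite -addbA addbb addbF.
Qed.

Definition widen_hom m n (le_mn : m <= n) : hom W m n :=
  Hom (proj2 (homs_generated W (widen_pt le_mn)) (generated_widen W le_mn)).

Lemma widen_homE m n (le_mn : m <= n) x :
  widen_hom le_mn x = (widen_ord le_mn x.1, x.2).
Proof. by rewrite ffunE. Qed.

(** * Moving the two letters of a map to new letters *)

Section Move.
Variables (n : nat) (f : hom W 2 n).

Definition move_base (b : 'I_2 -> bool) (y : 'I_n) : 'I_(n + 2) :=
  if [pick i | (ubase f i == y) && b i] is Some i then rshift n i else lshift 2 y.

Definition move_sign (b : 'I_2 -> bool) (y : 'I_n) : bool :=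
  if [pick i | (ubase f i == y) && b i] is Some i then usign f i else false.

Lemma move_base_inj b : injective (move_base b).
Proof.
move=> x y; rewrite /move_base.
case: pickP => [i /andP[/eqP<- _]|_]; case: pickP => [j /andP[/eqP<- _]|_].
- by move/rshift_inj ->.
- by move/eqP; rewrite eq_rlshift.
- by move/eqP; rewrite eq_lrshift.
- by move/lshift_inj.
Qed.

Lemma move_signA b : W = TypeA -> move_sign b =1 xpred0.
Proof.
by move=> WA y; rewrite /move_sign; case: pickP => // i _; rewrite usignA.
Qed.

(* The inclusion of n into n + 2, except that f i goes to the i-th new letter
   whenever b i. *)
Definition move_hom b : hom W n (n + 2) :=
  base_hom (@move_base_inj b) (@move_signA b).

Lemma move_homE b y :
  move_hom b y = (move_base b y.1, y.2 (+) move_sign b y.1).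
Proof. exact: base_homE. Qed.

(** A letter of f that h misses is never evaluated, so it is immaterial whether it moves. This is
    the source of the cancellations in the second difference. *)
Lemma move_hom_eq b b' p (h : hom W p n) :
    (forall i, ubase f i \in img h -> b i = b' i) ->
  comph (move_hom b) h = comph (move_hom b') h.
Proof.
move=> bb'; apply: hom_eqP => x; rewrite !comphE !move_homE /move_base /move_sign.
suff e : (fun i => (ubase f i == (h x).1) && b i) =1
         (fun i => (ubase f i == (h x).1) && b' i).
  by rewrite !(eq_pick e).
move=> i; case: eqP => //= e; apply: bb'.
by rewrite e homE /=; apply: imset_f.
Qed.

Definition push_base (y : 'I_(2 + 2)) : 'I_(n + 2) :=
  match split y with inl i => lshift 2 (ubase f i) | inr i => rshift n i end.

Definition push_sign (y : 'I_(2 + 2)) : bool :=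
  match split y with inl i => usign f i | inr i => false end.

Lemma push_base_inj : injective push_base.
Proof.
move=> x y; rewrite /push_base => e; apply: (can_inj (@splitK 2 2)); move: e.
case: (split x) (split y) => [i|i] [j|j].
- by move/lshift_inj/ubase_inj ->.
- by move/eqP; rewrite eq_lrshift.
- by move/eqP; rewrite eq_rlshift.
- by move/rshift_inj ->.
Qed.

Lemma push_signA : W = TypeA -> push_sign =1 xpred0.
Proof.
by move=> WA y; rewrite /push_sign; case: split => // i; rewrite usignA.
Qed.

(* The disjoint union of f with the identity of 2. *)
Definition push_hom : hom W (2 + 2) (n + 2) := base_hom push_base_inj push_signA.

End Move.

Lemma move_base_comp n (f : hom W 2 n) b i :
  move_base f b (ubase f i) = if b i then rshift n i else lshift 2 (ubase f i).
Proof.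
rewrite /move_base; case: pickP => [j /andP[/eqP/ubase_inj -> ->] //|/(_ i)].
by rewrite eqxx /= => ->.
Qed.

Lemma move_sign_comp n (f : hom W 2 n) b i :
  move_sign f b (ubase f i) = b i && usign f i.
Proof.
rewrite /move_sign; case: pickP => [j /andP[/eqP/ubase_inj -> ->] //|/(_ i)].
by rewrite eqxx /= => ->.
Qed.

Lemma ubase_id n i : ubase (idh W n) i = i.
Proof. by rewrite /ubase idhE. Qed.

Lemma usign_id n i : usign (idh W n) i = false.
Proof. by rewrite /usign idhE. Qed.

Lemma move_idE b (x : pt 2) :
  move_hom (idh W 2) b x = (if b x.1 then rshift 2 x.1 else lshift 2 x.1, x.2).
Proof.
case: x => i c; have := move_base_comp (idh W 2) b i.
have := move_sign_comp (idh W 2) b i.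
by rewrite move_homE ubase_id usign_id andbF => -> ->; rewrite addbF.
Qed.

(** The sign that [move_hom] puts on a moved letter cancels the one from f, so moving letters of f
    is the image under [push_hom f] of moving letters of the identity of 2. *)
Lemma move_push n (f : hom W 2 n) b :
  comph (move_hom f b) f = comph (push_hom f) (move_hom (idh W 2) b).
Proof.
apply: hom_eqP => x; rewrite !comphE move_homE base_homE move_idE !homE /=.
rewrite move_base_comp move_sign_comp /push_base /push_sign.
case: (b x.1) => /=.
  by rewrite (unsplitK (inr _ : 'I_2 + 'I_2)) -addbA addbb !addbF.
by rewrite (unsplitK (inl _ : 'I_2 + 'I_2)) addbF.
Qed.

End Homs.

(** * Counting graphs up to relabelling *)

(** The binomial is a product of e fractions (N - i) / (e - i), each at least N / e. In the
    induction this becomes (N + 1) e <= N (e + 1) for e <= N. *)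
Lemma expn_le_bin N e : e <= N -> N ^ e <= 'C(N, e) * e ^ e.
Proof.
elim: e N => [|e IH] [|N] // eN.
have IHN := IH N eN.
rewrite [in X in _ <= X]expnS mulnA [X in _ <= X * _]mulnC -mul_bin_diag expnS -mulnA /=.
rewrite leq_mul2l /=; case: e eN {IH} IHN => [|e] eN IHN; first by rewrite bin0.
rewrite -(@leq_pmul2r (e.+1 ^ e.+1)) ?expn_gt0 // -mulnA [X in _ <= _ * X]mulnC mulnA.
apply: leq_trans (leq_mul IHN (leqnn _)); rewrite -!expnMn leq_exp2r //.
by lia.
Qed.

(** Greedy choice: take a point x, discard the at most c points related to it, and recurse on the
    rest. *)
Lemma large_independent_set (T : finType) (r : rel T) (c : nat) (X : {set T}) :
    reflexive r -> symmetric r ->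
    (forall x, x \in X -> #|[set y in X | r x y]| <= c) ->
  exists Y : {set T},
    [/\ Y \subset X, {in Y &, forall x y, x != y -> ~~ r x y} &
        #|X| <= #|Y| * c].
Proof.
move=> rr rs; have [k le_k] := ubnP #|X|; elim: k X le_k => // k IH X le_k Xc.
have [->|[x xX]] := set_0Vmem X.
  by exists set0; split; [rewrite sub0set | move=> x y; rewrite inE | rewrite cards0].
pose X' := [set y in X | ~~ r x y].
have sX' : X' \subset X by apply/subsetP => y; rewrite inE => /andP[].
have [|y yX'|Y [sY iY cY]] := IH X'.
- rewrite -ltnS; apply: leq_trans le_k; apply: proper_card; apply/properP; split=> //.
  by exists x => //; rewrite inE rr andbF.
- apply: leq_trans (Xc y (subsetP sX' _ yX')); apply: subset_leq_card.
  by apply/subsetP => z; rewrite !inE => /andP[/andP[-> _] ->].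
have nr y : y \in Y -> ~~ r x y by move/(subsetP sY); rewrite inE => /andP[].
have xY : x \notin Y by apply/negP => /nr; rewrite rr.
exists (x |: Y); split.
- by rewrite subUset sub1set xX (subset_trans sY).
- move=> y z /setU1P[->|yY] /setU1P[->|zY]; rewrite ?eqxx //.
  + by move=> _; apply: nr.
  + by move=> _; rewrite rs; apply: nr.
  + exact: iY.
rewrite cardsU1 xY mulnDl mul1n.
have -> : X = [set y in X | r x y] :|: X'.
  by apply/setP => y; rewrite !inE -andb_orr orbN andbT.
by rewrite cardsU (leq_trans (leq_subr _ _)) // leq_add // Xc.
Qed.

Section Graphs.
Variable n : nat.
Implicit Types (s : 'I_n -> 'I_n) (g : {set {set 'I_n}}) (M : {set 'I_n}).

Definition relabel s g : {set {set 'I_n}} := [set s @: E | E : {set 'I_n} in g].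

Lemma card_relabel s g : injective s -> #|relabel s g| = #|g|.
Proof. by move=> si; apply/card_imset/imset_inj. Qed.

Lemma relabel_comp s t g : relabel (s \o t) g = relabel s (relabel t g).
Proof.
rewrite /relabel -imset_comp; apply: eq_imset => E /=; exact: imset_comp.
Qed.

Lemma relabel_id g : relabel id g = g.
Proof.
by rewrite /relabel (eq_imset (g := id)) ?imset_id // => E; rewrite /= imset_id.
Qed.

Definition graphs_on (M : {set 'I_n}) (e : nat) : {set {set {set 'I_n}}} :=
  [set g : {set {set 'I_n}} |
    g \subset [set E : {set 'I_n} | E \subset M & #|E| == 2] & #|g| == e].

Lemma card_graphs_on M e : #|graphs_on M e| = 'C('C(#|M|, 2), e).
Proof. by rewrite /graphs_on cards_draws cards_draws. Qed.

Lemma graphs_onP M e g :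
  reflect [/\ {in g, forall E : {set 'I_n}, E \subset M},
              {in g, forall E : {set 'I_n}, #|E| = 2} & #|g| = e]
          (g \in graphs_on M e).
Proof.
rewrite inE; apply: (iffP andP) => [[/subsetP gM /eqP ge]|[gM g2 ge]]; split=> //.
- by move=> E /gM; rewrite inE => /andP[].
- by move=> E /gM; rewrite inE => /andP[_ /eqP].
- by apply/subsetP => E Eg; rewrite inE gM //= g2.
- exact/eqP.
Qed.

(* A relabelling keeping g inside M only depends on a self-map of M. *)
Lemma card_relabelings (W : wtype) M e g : g \in graphs_on M e ->
  #|[set g' in graphs_on M e |
      [exists w : hom W n n, relabel (ubase w) g == g']]| <= #|M| ^ #|M|.
Proof.
move=> /graphs_onP[gM g2 ge].
(* For empty M the only graph is the empty one and the bound is 0 ^ 0 = 1. Otherwise y in M serves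
   as a default value. *)
have [M0|[y yM]] := set_0Vmem M.
  have g0 g' : g' \in graphs_on M e -> g' = set0.
    case/graphs_onP => g'M g'2 _; apply/setP => E; rewrite inE; apply/negP => Eg'.
    have := g'2 _ Eg'; suff -> : E = set0 by rewrite cards0.
    by apply/eqP; rewrite -subset0 -M0 g'M.
  rewrite M0 cards0 expn0 -(cards1 (set0 : {set {set 'I_n}})).
  apply: subset_leq_card; apply/subsetP => g' /setIdP[g'X _].
  by move: g'X; rewrite -M0 => /g0 ->; rewrite inE.
rewrite -(card_pffun_on y (mem M) (mem M)).
apply: leq_trans (leq_imset_card (fun F : {ffun 'I_n -> 'I_n} => relabel F g) _).
apply: subset_leq_card; apply/subsetP => g'.
case/setIdP => /graphs_onP[g'M _ _] /existsP[w /eqP wg].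
(* A vertex of M that w takes out of M lies on no edge of g, because the relabelled graph stays
   inside M; changing its image to y leaves the relabelled graph unchanged. *)
pose F := [ffun i => if (i \in M) && (ubase w i \in M) then ubase w i else y].
apply/imsetP; exists F.
  apply/pffun_onP; split.
    by apply/subsetP => i; rewrite inE ffunE; case: (i \in M) => //; rewrite eqxx.
  by move=> _ /imageP[i _ ->]; rewrite ffunE; case: ifP => // /andP[].
rewrite -wg; apply: eq_in_imset => E Eg; apply: eq_in_imset => i iE.
have iM : i \in M := subsetP (gM _ Eg) _ iE.
have wEM : ubase w @: E \subset M by apply: g'M; rewrite -wg; apply: imset_f.
by rewrite ffunE iM (subsetP wEM) //; apply: imset_f.
Qed.

(** An isomorphism class has at most [#|M| ^ #|M|] members on M, so the greedy choice finds many
    non-isomorphic graphs. Having the same number of edges, they cannot contain relabellings of one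
    another. *)
Lemma many_graphs (W : wtype) M e :
  exists Y : {set {set {set 'I_n}}},
    [/\ {in Y, forall g, #|g| = e},
        {in Y, forall g, {in g, forall E : {set 'I_n}, #|E| = 2}},
        {in Y &, forall g g', g != g' ->
           forall w : hom W n n, ~~ (relabel (ubase w) g \subset g')} &
        'C('C(#|M|, 2), e) <= #|Y| * #|M| ^ #|M|].
Proof.
pose r : rel {set {set 'I_n}} :=
  fun g g' => [exists w : hom W n n, relabel (ubase w) g == g'].
have relE (w v : hom W n n) g :
    relabel (ubase w) (relabel (ubase v) g) = relabel (ubase (comph w v)) g.
  rewrite -relabel_comp /relabel; apply: eq_imset => E; apply: eq_imset => i.
  by rewrite /= ubase_comp.
have rel1 g : relabel (ubase (idh W n)) g = g.
  rewrite -[RHS]relabel_id; apply: eq_imset => E; apply: eq_imset => i.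
  exact: ubase_id.
have rr : reflexive r by move=> g; apply/existsP; exists (idh W n); rewrite rel1.
have r_sub g g' : r g g' -> r g' g.
  move=> /existsP[w /eqP <-]; have [v _ vw] := hom_invertible w.
  by apply/existsP; exists v; rewrite relE vw rel1.
have rs : symmetric r by move=> g g'; apply/idP/idP => /r_sub.
have [Y [sY iY cY]] := large_independent_set rr rs
  (fun g gX => @card_relabelings W M e g gX).
have YP g (gY : g \in Y) := graphs_onP _ _ _ (subsetP sY _ gY).
exists Y; split.
- by move=> g /YP[].
- by move=> g /YP[].
- move=> g g' gY g'Y gg' w; apply/negP => sub.
  have /negP[] := iY _ _ gY g'Y gg'; apply/existsP; exists w.
  rewrite eqEcard sub card_relabel /=; last exact: ubase_inj.
  by have [_ _ ->] := YP _ gY; have [_ _ ->] := YP _ g'Y.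
- by rewrite -card_graphs_on.
Qed.

End Graphs.

(** The choice m = 4 s + 1 makes 'C(m, 2) = 2 s m, exactly s times the number 2 m of edges drawn,
    while m <= 5 s bounds the number of relabellings. *)
Lemma bin_edges_ge s Y Q (m := (4 * s).+1) : 0 < s -> 5 * Q <= s ->
  'C('C(m, 2), 2 * m) <= Y * m ^ m -> Q ^ m <= Y.
Proof.
move=> s0 Qs.
have -> : 'C(m, 2) = 2 * s * m.
  by rewrite bin2 /m /=; rewrite -[_ * (4 * s)]mulnC -divn2; nia.
move=> H.
have le_e : 2 * m <= 2 * s * m by rewrite leq_mul2r; lia.
have H1 : s ^ (2 * m) <= 'C(2 * s * m, 2 * m).
  have := expn_le_bin le_e.
  have -> : 2 * s * m = s * (2 * m) by lia.
  by rewrite expnMn leq_pmul2r // expn_gt0; lia.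
have H2 : s ^ (2 * m) <= Y * (5 * s) ^ m.
  apply: leq_trans H1 (leq_trans H _); rewrite leq_mul2l leq_exp2r //.
  by apply/orP; right; rewrite /m; lia.
have H3 : s ^ m <= Y * 5 ^ m.
  rewrite -(@leq_pmul2r (s ^ m)) ?expn_gt0 ?s0 // -expnD addnn -mul2n -mulnA.
  by rewrite -expnMn.
rewrite -(@leq_pmul2r (5 ^ m)) ?expn_gt0 // -expnMn mulnC.
by apply: leq_trans H3; rewrite leq_exp2r // mulnC.
Qed.

From mathcomp Require Import boolp classical_sets reals topology normedtype sequences.
Import numFieldNormedType.Exports.
Local Open Scope ring_scope.

(** * Functionals, traces and invariants *)

Section LinearFunctionals.
Variables (k : fieldType) (T : lmodType k).

(* A maximal subspace avoiding v is a complement of the line spanned by v. *)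
Lemma separating_functional (v : T) : v != 0 ->
  exists f : {linear T -> k^o}, f v != 0.
Proof.
move=> v0.
pose P (A : set T) := (forall (a : k) x y, A x -> A y -> A (a *: x + y)) /\ ~ A v.
have [F FP Ftot|A [[Alin Av] Amax]] := @Zorn_bigcup T P.
  split=> [a x y [X FX Xx] [Y FY Yy]|[X FX Xv]]; last by have [_] := FP _ FX; apply.
  case: (Ftot _ _ FX FY) => [XY|YX].
    by exists Y => //; apply: (FP _ FY).1 => //; apply: XY.
  by exists X => //; apply: (FP _ FX).1 => //; apply: YX.
(* [P] also holds of the empty set, the union of the empty chain; comparing A with the zero subspace
   excludes it. *)
have A0 : A 0.
  apply: contrapT => nA0; apply: (Amax [set 0]%classic).
    split; last by move=> /(_ 0 erefl).
    move=> x Ax; exfalso; apply: nA0.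
    by have := Alin (-1) _ _ Ax Ax; rewrite scaleN1r addNr.
  split; first by move=> a x y -> ->; rewrite scaler0 addr0.
  by move/eqP; apply/negP.
have AZ a x : A x -> A (a *: x) by move=> Ax; rewrite -[_ *: _]addr0; apply: Alin.
(* Otherwise the span B of A and x is strictly larger and still avoids v: writing v = a x + h with h
   in A forces a to be nonzero, and then c = 1 / a works. *)
have dec x : exists c : k, A (x - c *: v).
  apply: contrapT => nx; pose B := [set y | exists a h, A h /\ y = a *: x + h]%classic.
  apply: (Amax B).
    split; first by move=> h Ah; exists 0, h; rewrite scale0r add0r.
    move=> /(_ x) BA; apply: nx; exists 0; rewrite scale0r subr0; apply: BA.
    by exists 1, 0; rewrite scale1r addr0.
  split.
    move=> a _ _ [b [h [Ah ->]]] [c [l [Al ->]]].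
    exists (a * b + c), (a *: h + l); split; first exact: Alin.
    by rewrite scalerDr scalerA scalerDl addrACA.
  move=> [a [h [Ah vE]]]; have [a0|a0] := eqVneq a 0.
    by apply: Av; rewrite vE a0 scale0r add0r.
  apply: nx; exists a^-1; rewrite vE scalerDr scalerA mulVf // scale1r.
  by rewrite opprD addrA subrr add0r -scaleNr; apply: AZ.
have decU x c c' : A (x - c *: v) -> A (x - c' *: v) -> c = c'.
  move=> Ac Ac'; apply: contrapT => /eqP ncc'; apply: Av.
  have -> : v = (c - c')^-1 *: (-1 *: (x - c *: v) + (x - c' *: v)).
    rewrite scaleN1r opprB addrA subrK -scalerBl scalerA mulVf ?scale1r //.
    by rewrite subr_eq0.
  exact/AZ/Alin.
have [f fP] := choice dec.
have f_lin : linear (f : T -> k^o).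
  move=> a x y; apply: (decU (a *: x + y)) (fP _) _.
  rewrite scalerDl -scalerA opprD addrACA -scalerBr.
  exact: Alin.
pose F : {linear T -> k^o} := HB.pack f (GRing.isLinear.Build k T k^o _ f f_lin).
exists F; suff -> : F v = 1 by rewrite oner_neq0.
by apply: (decU v) (fP v) _; rewrite scale1r subrr.
Qed.

Hypothesis k0 : [pchar k] =i pred0.

Lemma pchar0_natr_inj : injective (fun m => m%:R : k).
Proof.
have kn := (pcharf0P k).1 k0.
suff le m p : (m <= p)%N -> m%:R = p%:R :> k -> m = p.
  by move=> m p; case/orP: (leq_total m p) => h e; [|symmetry]; apply: le.
move=> mp e; apply/eqP; rewrite eqn_leq mp -subn_eq0 -kn natrB //=.
by rewrite e subrr.
Qed.

Lemma exists_nonroot (p : {poly k}) : p != 0 -> exists c, p.[c] != 0.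
Proof.
move=> p0; apply: contrapT => np.
have rt c : root p c by apply/negP => /negP h; apply: np; exists c.
have := @max_poly_roots _ p [seq m%:R | m <- iota 0 (size p)] p0.
rewrite map_inj_uniq ?iota_uniq ?size_map ?size_iota ?ltnn; last exact: pchar0_natr_inj.
by move=> /(_ _ isT) h; have /h : all (root p) [seq m%:R | m <- iota 0 (size p)] by apply/allP.
Qed.

(** Over an infinite field finitely many proper subspaces do not cover L. If f is nonzero on s and g
    at v, each factor f w + g w X of [p] is a nonzero polynomial, and any c that is not a root of
    [p] makes f + c g nonzero everywhere. *)
Lemma nonvanishing_combination (L : (T -> k) -> Prop) (s : seq T) :
    L (fun=> 0) ->
    (forall c f g, L f -> L g -> L (fun x => f x + c * g x)) ->
    {in s, forall v, exists2 f, L f & f v != 0} ->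
  exists2 f, L f & {in s, forall v, f v != 0}.
Proof.
move=> L0 LD; elim: s => [|v s IH] sP; first by exists (fun=> 0).
have [|f Lf fs] := IH; first by move=> w ws; apply: sP; rewrite inE ws orbT.
have [g Lg gv] := sP v (mem_head _ _).
pose p := \prod_(w <- v :: s) ((f w)%:P + g w *: 'X).
have [|c] := @exists_nonroot p.
  rewrite prodf_seq_neq0; apply/allP => w /=; rewrite inE => /orP[/eqP ->|/fs fw].
    apply/negP => /eqP/(congr1 (fun p : {poly k} => p`_1)); rewrite coefD coefC coefZ coefX coef0.
    by rewrite add0r mulr1 => /eqP; rewrite (negPf gv).
  apply/negP => /eqP/(congr1 (fun p : {poly k} => p`_0)); rewrite coefD coefC coefZ coefX coef0.
  by rewrite mulr0 addr0 => /eqP; rewrite (negPf fw).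
rewrite horner_prod prodf_seq_neq0 => /allP pc.
exists (fun x => f x + c * g x); first exact: LD.
by move=> w /pc; rewrite hornerD hornerC hornerZ hornerX mulrC.
Qed.

End LinearFunctionals.

Section Combinations.
Variables (k : fieldType) (T : lmodType k).

Definition mxcomb m r (M : 'M[k]_(m, r)) (b : 'I_r -> T) (i : 'I_m) : T :=
  \sum_j M i j *: b j.

Definition lfree r (b : 'I_r -> T) :=
  forall c : 'I_r -> k, \sum_i c i *: b i = 0 -> forall i, c i = 0.

Lemma mxcomb_mul m r p (M : 'M_(m, r)) (N : 'M_(r, p)) b :
  mxcomb (M *m N) b =1 mxcomb M (mxcomb N b).
Proof.
move=> i; rewrite /mxcomb; under [RHS]eq_bigr do rewrite scaler_sumr.
rewrite exchange_big; apply: eq_bigr => j _; rewrite mxE scaler_suml.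
by apply: eq_bigr => l _; rewrite scalerA.
Qed.

Lemma mxcomb1 r (b : 'I_r -> T) : mxcomb 1%:M b =1 b.
Proof.
move=> i; rewrite /mxcomb (bigD1 i) //= big1 ?addr0 ?mxE ?eqxx ?scale1r // => j ji.
by rewrite mxE eq_sym (negPf ji) scale0r.
Qed.

Lemma eq_mxcomb m r (M : 'M_(m, r)) b b' : b =1 b' -> mxcomb M b =1 mxcomb M b'.
Proof. by move=> bb' i; apply: eq_bigr => j _; rewrite bb'. Qed.

Lemma mxcomb_inj m r (b : 'I_r -> T) (M N : 'M_(m, r)) :
  lfree b -> mxcomb M b =1 mxcomb N b -> M = N.
Proof.
move=> bfree MN; apply/matrixP => i j; apply/eqP; rewrite -subr_eq0; apply/eqP.
apply: (bfree (fun j => M i j - N i j)).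
under eq_bigr do rewrite scalerBl.
by rewrite sumrB; apply/eqP; rewrite subr_eq0; apply/eqP/MN.
Qed.

Lemma linear_mxcomb (f : {linear T -> T}) m r (M : 'M_(m, r)) b i :
  f (mxcomb M b i) = mxcomb M (f \o b) i.
Proof. by rewrite linear_sum; apply: eq_bigr => j _; rewrite linearZ. Qed.

Lemma basis_mxcomb (G : T -> Prop) r (b : 'I_r -> T) m (v : 'I_m -> T) :
  is_basis G b -> (forall i, G (v i)) -> exists M : 'M_(m, r), v =1 mxcomb M b.
Proof.
move=> [_ _ bspan] Gv.
have /choice[c cE] i : exists c : 'I_r -> k, v i = \sum_j c j *: b j := bspan _ (Gv i).
exists (\matrix_(i, j) c i j) => i; rewrite cE.
by apply: eq_bigr => j _; rewrite mxE.
Qed.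

(** The value chosen by [xget] is unique: for two bases with transition matrices P and Q, N = Q M P
    and P Q = 1, so the traces agree by cyclicity. *)
Lemma trace_onE (G : T -> Prop) (f : {linear T -> T}) r (b : 'I_r -> T) (M : 'M_r) :
  is_basis G b -> f \o b =1 mxcomb M b -> trace_on G f = \tr M.
Proof.
move=> bB fb; apply: xget_unique; first by exists r, b, M.
move=> _ [r' [b' [N [b'B fb' ->]]]].
have [bG bfree _] := bB; have [b'G b'free _] := b'B.
have [P bP] := basis_mxcomb b'B bG; have [Q b'Q] := basis_mxcomb bB b'G.
have PQ : P *m Q = 1%:M.
  apply: (mxcomb_inj bfree) => i.
  by rewrite mxcomb_mul mxcomb1 bP; apply: eq_mxcomb => j; rewrite -b'Q.
have -> : N = Q *m (M *m P).
  apply: (mxcomb_inj b'free) => i; rewrite [LHS](_ : _ = f (b' i)); last by rewrite fb'.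
  rewrite b'Q linear_mxcomb mxcomb_mul; apply: eq_mxcomb => j.
  by rewrite fb mxcomb_mul; apply: eq_mxcomb => l; apply: bP.
by rewrite mxtrace_mulC -mulmxA PQ mulmx1.
Qed.

End Combinations.

(** In a full rank factorization M = C B, idempotence cancels to B C = 1, whose size is the rank. *)
Lemma mxtrace_idempotent (k : fieldType) r (M : 'M[k]_r) :
  M *m M = M -> \tr M = (\rank M)%:R.
Proof.
move=> MM; have := mulmx_base M; have := row_base_free M; have := col_base_full M.
move: (col_base M) (row_base M) => C B Cfull Bfree CB.
suff BC : B *m C = 1%:M by rewrite -[in LHS]CB mxtrace_mulC BC mxtrace1.
apply: (row_free_inj Bfree); apply: (row_full_inj Cfull).
by rewrite /= mul1mx !mulmxA CB -mulmxA CB.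
Qed.

Section Invariants.
Variables (R : realType) (k : fieldType) (iota : {rmorphism k -> Cplx R}).

Lemma subfield_pchar0 : [pchar k] =i pred0.
Proof.
apply/(pcharf0P k) => n.
by rewrite -(fmorph_eq0 iota) rmorph_nat pnatr_eq0.
Qed.

Definition cp_one (W : wtype) : charpoly k W :=
  @CharPoly k W 0 (mpoly.mpolyC _ 1).

Lemma cp_eval_one W n (w : hom W n n) : cp_eval (cp_one W) w = 1.
Proof. exact: mpoly.mevalC. Qed.

(** The inner product with 1 is the trace of the averaging projection [Pi], hence its rank. The
    coordinates C of the invariants satisfy C Pi = C and have independent rows, so this rank is at
    least K. *)
Lemma char_inner_one_ge W (A : gradedFIWalg k W) n d K (a : 'I_K -> A n) :
    finite_dim (@ga_gr k W A n d) ->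
    (forall i, ga_gr d (a i)) -> lfree a ->
    (forall (w : hom W n n) i, ga_map A w (a i) = a i) ->
  exists2 N, (K <= N)%N & char_inner iota (cp_one W) A n d = N%:R.
Proof.
move=> [r [b bB]] aG afree ainv; have [bG bfree _] := bB.
have /choice[rho rhoE] (w : hom W n n) : exists M : 'M[k]_r, ga_map A w \o b =1 mxcomb M b.
  by apply: (basis_mxcomb bB) => i; apply/ga_map_gr/bG.
(* The rows of [rho w] are the images of the basis vectors, which reverses products. *)
have rhoM v w : rho (comph v w) = rho w *m rho v.
  apply: (mxcomb_inj bfree) => i.
  rewrite -rhoE mxcomb_mul /= ga_mapM -[ga_map A w (b i)]/((ga_map A w \o b) i) rhoE.
  by rewrite (linear_mxcomb (ga_map A v)); apply: eq_mxcomb => j; apply: rhoE.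
pose G := #|{: hom W n n}|.
have G0 : (0 < G)%N by apply/card_gt0P; exists (idh W n).
have Gk : G%:R != 0 :> k.
  by rewrite ((pcharf0P k).1 subfield_pchar0) -lt0n.
pose Pi := G%:R^-1 *: \sum_w rho w.
have Pirho v : rho v *m Pi = Pi.
  rewrite -scalemxAr mulmx_sumr; congr (_ *: _).
  rewrite [RHS](reindex_inj (@comph_injl W n n v)).
  by apply: eq_bigr => w _; rewrite rhoM.
have PiPi : Pi *m Pi = Pi.
  rewrite {1}/Pi -scalemxAl mulmx_suml; under eq_bigr do rewrite Pirho.
  by rewrite sumr_const -scaler_nat scalerA mulVf ?scale1r.
have [C aC] := basis_mxcomb bB aG.
have Crho w : C *m rho w = C.
  apply: (mxcomb_inj bfree) => i; rewrite -aC mxcomb_mul -(ainv w) aC.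
  by rewrite (linear_mxcomb (ga_map A w)); apply: eq_mxcomb => j; rewrite -rhoE.
have CPi : C *m Pi = C.
  rewrite -scalemxAr mulmx_sumr; under eq_bigr do rewrite Crho.
  by rewrite sumr_const -scaler_nat scalerA mulVf ?scale1r.
exists (\rank Pi).
  have Cfree : row_free C.
    apply/row_freeP; apply: contrapT => nC.
    have : ~~ row_free C by apply/negP => /row_freeP.
    rewrite -kermx_eq0 => /rowV0Pn[u /sub_kermxP uC] /negP; apply.
    apply/eqP/rowP => i; rewrite mxE; apply: (afree (u 0)).
    rewrite -[LHS]/(mxcomb u a 0).
    by rewrite (eq_mxcomb u aC) -mxcomb_mul uC /mxcomb big1 // => j _; rewrite mxE scale0r.
  by rewrite -(eqP Cfree) -CPi mxrankM_maxr.
have chE w : alg_char A d w = \tr (rho w).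
  exact: (trace_onE (f := ga_map A w) bB (rhoE w)).
rewrite /char_inner /inner_prod.
under eq_bigr do rewrite cp_eval_one rmorph1 mul1r chE.
rewrite -rmorph_sum -rmorph_sum -raddf_sum /=.
(* Conjugation fixes the averaged trace, a natural number. *)
have <- : (iota (G%:R^-1 * \tr (\sum_w rho w)))^* = (\rank Pi)%:R.
  by rewrite -mxtraceZ -/Pi mxtrace_idempotent // rmorph_nat conjC_nat.
by rewrite rmorphM rmorphM fmorphV rmorph_nat fmorphV /= conjC_nat.
Qed.

End Invariants.

(** * The second difference operator *)

Section Difference.
Variables (k : fieldType) (W : wtype).

Definition which (b0 b1 : bool) (i : 'I_2) : bool := if i == ord0 then b0 else b1.

Lemma forall_I2 (P : 'I_2 -> Prop) : P ord0 -> P (lift ord0 ord0) -> forall i, P i.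
Proof. by move=> P0 P1 i; case: (unliftP ord0 i) => [j|] ->; rewrite ?ord1. Qed.

(* The second difference operator along f: it kills the tensors h (x) u unless h
   meets both letters of f. *)
Definition diffop (V : FIWmod k W) n (f : hom W 2 n) (y : V n) : V (n + 2)%N :=
  fm_map V (move_hom f (which false false)) y
  - fm_map V (move_hom f (which true false)) y
  - fm_map V (move_hom f (which false true)) y
  + fm_map V (move_hom f (which true true)) y.

Lemma diffop_is_linear V n (f : hom W 2 n) : linear (@diffop V n f).
Proof.
move=> a x y; rewrite /diffop !linearP !scalerDr.
by rewrite (AC ((2*2*2)*2) ((1*3*5*7)*(2*4*6*8))).
Qed.

HB.instance Definition _ (V : FIWmod k W) n (f : hom W 2 n) :=
  GRing.isLinear.Build k (V n) (V (n + 2)%N) _ (@diffop V n f) (diffop_is_linear f).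

(** Some letter i of f is missed by h. The four terms pair off according to whether i moves, with
    equal values and opposite signs. *)
Lemma diffop_eq0 (V : FIWmod k W) n (f h : hom W 2 n) (x : V 2) :
  img h != img f -> diffop f (fm_map V h x) = 0.
Proof.
move=> hf; have /existsP[i ih] : [exists i, ubase f i \notin img h].
  apply: contraR hf => /existsPn fh; rewrite eq_sym eqEcard !card_img leqnn andbT.
  by apply/fintype.subsetP => _ /imsetP[i _ ->]; apply/negPn/fh.
have E b b' : (forall j, j != i -> b j = b' j) ->
    fm_map V (move_hom f b) (fm_map V h x) = fm_map V (move_hom f b') (fm_map V h x).
  move=> bb'; rewrite -!fm_mapM (@move_hom_eq W n f b b') // => j jh; apply: bb'.
  by apply: contraTneq jh => ->.
rewrite /diffop; case: (unliftP ord0 i) E => [j ->|->] E; rewrite ?ord1 in E *.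
  rewrite -(E (which false false) (which false true)); last exact: forall_I2.
  rewrite -(E (which true false) (which true true)); last exact: forall_I2.
  by rewrite addrAC subrK subrr.
rewrite -(E (which false false) (which true false)); last exact: forall_I2.
rewrite -(E (which false true) (which true true)); last exact: forall_I2.
by rewrite subrr sub0r addNr.
Qed.

Lemma diffop_push (V : FIWmod k W) n (f : hom W 2 n) (x : V 2) :
  diffop f (fm_map V f x) = fm_map V (push_hom f) (diffop (idh W 2) x).
Proof.
by rewrite /diffop -!fm_mapM !move_push !(linearD, linearN) -!fm_mapM.
Qed.

Lemma diffop_morph (V M : FIWmod k W) (i : forall n, {linear M n -> V n}) n
    (f : hom W 2 n) y :
    (forall m n (f : hom W m n) x, i n (fm_map M f x) = fm_map V f (i m x)) ->
  i _ (diffop f y) = diffop f (i _ y).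
Proof. by move=> iE; rewrite /diffop !(linearD, linearN) !iE. Qed.

(** The linear map [l] given by the universal property reads off the coefficient along [f0], the
    unmoved term: [tf] sends [f0] w (x) v to w v and all other tensors to 0. It takes the second
    difference to u. *)
Lemma diffop_free_neq0 (U : Wrep k W 2) (M : FIWmod k W)
    (tau : forall n, hom W 2 n -> {linear U -> M n}) (u : U) n
    (h : hom W (2 + 2) n) :
    is_free_FIWmod tau -> u != 0 ->
  fm_map M h (diffop (idh W 2) (tau 2%N (idh W 2) u)) != 0.
Proof.
move=> [_ tau_map tau_univ] u0.
pose f0 := comph h (move_hom (idh W 2) (which false false)).
pose tf (f : hom W 2 n) (v : U) : U := \sum_(w | f == comph f0 w) wr_act U w v.
have tf_lin f : linear (tf f).
  move=> a x y; rewrite /tf scaler_sumr -big_split.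
  by apply: eq_bigr => w _; rewrite linearP.
pose t f : {linear U -> U} :=
  HB.pack (tf f) (GRing.isLinear.Build k U U _ (tf f) (tf_lin f)).
have tbal : balanced t.
  move=> f w v; rewrite /= /tf (reindex_inj (@comph_injl W 2 2 w)).
  apply: eq_big => [w'|w' _]; last by rewrite wr_actM.
  by rewrite comphA (inj_eq (@comph_injl W 2 n w)).
have [l [lE _]] := tau_univ n U t tbal.
apply: contraNneq u0 => /(congr1 l)/eqP.
rewrite linear0 /diffop !(linearD, linearN) !tau_map !lE !comph1.
have t0 b0 b1 : b0 || b1 -> t (comph h (move_hom (idh W 2) (which b0 b1))) u = 0.
  move=> b01; rewrite /= /tf big1 // => w /eqP e; exfalso.
  have [i bi] : exists i, which b0 b1 i.
    by case/orP: b01 => b; [exists ord0 | exists (lift ord0 ord0)].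
  (* The letter i moves to one of the two new letters, which [f0] never reaches. *)
  have := congr1 (fun f : hom W 2 n => f (i, false)) e.
  rewrite /f0 !comphE => /hom_inj; rewrite !move_idE bi /which if_same => /(congr1 fst)/eqP.
  by rewrite eq_rlshift.
rewrite (t0 true false) // (t0 false true) // (t0 true true) //.
rewrite !subr0 addr0 /= /tf (big_pred1 (idh W 2)) ?wr_act1 // => w.
by rewrite -/f0 -[X in X == _]comph1 (inj_eq (@comph_injr W 2 2 n f0)) eq_sym.
Qed.

(* If each homogeneous component died under some morphism, all of them would die at
   a common stage, where the tensor id (x) u itself survives. *)
Lemma persistent_generator (V : gradedFIWmod k W) :
    positively_graded V -> contains_free_on V 2 ->
  exists (d : nat) (x : V 2%N),
    [/\ (0 < d)%N, gm_gr d x &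
        forall n (h : hom W (2 + 2) n), fm_map V h (diffop (idh W 2) x) != 0].
Proof.
move=> Vpos [U [M [tau [[u u0] tau_free [i [iE i_inj]]]]]].
have [N [c [cG xE]]] := gr_span (gm_grading V 2) (i 2%N (tau 2%N (idh W 2) u)).
apply: contrapT => noP.
(* From stage [st d] on, the standard inclusion kills the second difference of the component
   [c d]. *)
have /choice[st stP] d : exists p, forall n (le_n : (2 + 2 <= n)%N), (p <= n)%N ->
    fm_map V (widen_hom W le_n) (diffop (idh W 2) (c d)) = 0.
  have [n [h h0]] : exists n (h : hom W (2 + 2) n),
      fm_map V h (diffop (idh W 2) (c d)) = 0.
    case: d => [|d].
      by exists (2 + 2)%N, (idh W _); rewrite (Vpos _ _ (cG 0%N)) !linear0.
    apply: contrapT => nh; apply: noP; exists d.+1, (c d.+1); split=> // n h.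
    by apply/eqP => h0; apply: nh; exists n, h.
  (* Following the killing map h by g gives a standard inclusion, so every later standard inclusion
     factors through h. *)
  exists (2 + 2 + n)%N => p le4p lenp; have [g gE] := hom_retract h.
  have -> : widen_hom W le4p = comph (widen_hom W lenp) (comph g h).
    apply: hom_eqP => x; rewrite comphE gE !widen_homE /=.
    by congr (_, _); apply: val_inj.
  by rewrite !fm_mapM h0 !linear0.
have le4 : (2 + 2 <= 2 + 2 + \sum_(d < N) st d)%N by rewrite leq_addr.
have /eqP[] := diffop_free_neq0 (widen_hom W le4) tau_free u0.
apply: (i_inj _); rewrite linear0 iE diffop_morph // xE !linear_sum.
apply: big1 => d _; apply: stP; rewrite (leq_trans _ (leq_addl _ _)) //.
by rewrite (bigD1 d) //= leq_addr.
Qed.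
End Difference.

(** * Graph monomials *)

Section Monomials.
Variables (k : fieldType) (W : wtype).
Hypothesis k0 : [pchar k] =i pred0.

Section Functionals.
Variables (V : FIWmod k W) (x : V 2%N).
Hypothesis x_persists :
  forall n (h : hom W (2 + 2) n), fm_map V h (diffop (idh W 2) x) != 0.

(** For h over E, [diffop h] kills all translates over other edges but not h x, so a functional
    separating its value from 0 is nonzero at h x. One combination of these is nonzero at all h over
    E at once. *)
Lemma edge_functional n (E : {set 'I_n}) :
  exists f : {linear V n -> k^o},
    forall h : hom W 2 n, (f (fm_map V h x) != 0) = (img h == E).
Proof.
pose L (f : V n -> k) := linear (f : V n -> k^o) /\
  forall h : hom W 2 n, img h != E -> f (fm_map V h x) = 0.
have [||_ /mapP[h + ->]|f [f_lin f0] f_neq0] := @nonvanishing_combination k (V n) k0 L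
  [seq fm_map V h x | h <- enum [pred h : hom W 2 n | img h == E]].
- by split=> // a y z; rewrite scaler0 addr0.
- move=> c f g [f_lin f0] [g_lin g0]; split=> [a y z|h hE]; last first.
    by rewrite f0 // g0 // mulr0 addr0.
  have fE : f (a *: y + z) = a * f y + f z := f_lin a y z.
  have gE : g (a *: y + z) = a * g y + g z := g_lin a y z.
  rewrite -[RHS]/(a * (f y + c * g y) + (f z + c * g z)) fE gE.
  by rewrite mulrDr [c * (a * _)]mulrCA addrACA -mulrDr.
- rewrite mem_enum inE => /eqP hE.
  have [|f fx] := @separating_functional k _ (diffop h (fm_map V h x)).
    by rewrite diffop_push; apply: x_persists.
  exists (f \o diffop h) => //; split; first by move=> a y z; rewrite /= !linearP.
  by move=> h' h'E; rewrite /= diffop_eq0 ?linear0 // hE.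
pose F : {linear V n -> k^o} := HB.pack f (GRing.isLinear.Build k (V n) k^o _ f f_lin).
exists F => h; apply/idP/eqP => [|hE].
  by apply: contraNeq => hE; apply/eqP/f0.
by apply: f_neq0; apply: map_f; rewrite mem_enum inE hE.
Qed.

(** The edge functionals are summed over the edges of g; on h x only the summand of the edge under h
    survives. *)
Lemma graph_functional n :
  exists2 c : hom W 2 n -> k, (forall h, c h != 0) &
    forall g : {set {set 'I_n}}, exists f : {linear V n -> k^o},
      forall h : hom W 2 n, f (fm_map V h x) = if img h \in g then c h else 0.
Proof.
have [f fE] := choice (@edge_functional n).
exists (fun h => f (img h) (fm_map V h x)) => [h|g]; first by rewrite fE.
pose F y : k^o := \sum_(E in g) f E y.
have F_lin : linear F.
  move=> a y z; rewrite /F scaler_sumr -big_split.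
  by apply: eq_bigr => E _; rewrite linearP.
pose Fl : {linear V n -> k^o} := HB.pack F (GRing.isLinear.Build k (V n) k^o _ F F_lin).
exists Fl => h; rewrite -[LHS]/(F _).
have f0 E : E != img h -> f E (fm_map V h x) = 0.
  by rewrite eq_sym -fE => /negPn/eqP.
rewrite /F; case: ifP => hg.
  by rewrite (bigD1 (img h)) //= big1 ?addr0 // => E /andP[_ /f0].
by rewrite big1 // => E Eg; apply: f0; apply: contraTneq Eg => ->; rewrite hg.
Qed.

End Functionals.

Lemma grading_sum (T : lmodType k) (G : nat -> T -> Prop) d (I : finType) (F : I -> T) :
  is_grading G -> (forall i, G d (F i)) -> G d (\sum_i F i).
Proof.
move=> GG GF; elim/big_ind: _ => // [|y z Gy Gz]; first exact: gr0.
by rewrite -[y]scale1r; apply: grP.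
Qed.

Lemma ga_gr_prod (A : gradedFIWalg k W) n d (I : finType) (P : pred I) (F : I -> A n) :
  (forall i, ga_gr d (F i)) -> ga_gr (#|P| * d)%N (\prod_(i in P) F i).
Proof.
move=> GF; rewrite -sum_nat_const; apply: (big_ind2 (fun m y => ga_gr m y)) => //.
  exact: ga_gr_one.
by move=> m y m' y'; apply: ga_gr_mul.
Qed.

Lemma card_hom_graph n (g : {set {set 'I_n}}) :
    {in g, forall E : {set 'I_n}, #|E| = 2} ->
  #|[pred h : hom W 2 n | img h \in g]| = (#|g| * #|{: hom W 2 2}|)%N.
Proof.
move=> g2; rewrite -[LHS]sum1_card (partition_big (@img W 2 n) (fun E => E \in g)) //=.
rewrite (eq_bigr (fun=> #|{: hom W 2 2}|)) ?sum_nat_const // => E Eg.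
rewrite -(card_hom_img W (g2 _ Eg)) -sum1_card; apply: eq_bigl => h.
by rewrite !inE; case: eqP => [->|]; rewrite ?Eg ?andbF.
Qed.

(* Orbit sums of the graph monomials x_g, the product of h(x) over all maps h
   onto an edge of g.  The point mu_g of Spec S_n sends a translate w x_g' to 0
   unless w g' is contained in g. *)
Lemma graph_invariants (V : gradedFIWmod k W) (A : gradedFIWalg k W) (x : V 2%N) d
    n (e : nat) (Y : {set {set {set 'I_n}}}) :
    (forall n (h : hom W (2 + 2) n), fm_map V h (diffop (idh W 2) x) != 0) ->
    gm_gr d x -> contains_sym_alg A V ->
    {in Y, forall g : {set {set 'I_n}}, #|g| = e} ->
    {in Y, forall g : {set {set 'I_n}}, {in g, forall E : {set 'I_n}, #|E| = 2}} ->
    {in Y &, forall g g', g != g' ->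
       forall w : hom W n n, ~~ (relabel (ubase w) g \subset g')} ->
  exists a : 'I_#|Y| -> A n,
    [/\ forall i, ga_gr (e * #|{: hom W 2 2}| * d)%N (a i), lfree a &
        forall (w : hom W n n) i, ga_map A w (a i) = a i].
Proof.
move=> xP xd [S [j [[_ jmap jgr juniv] [i [imap igr i_inj]]]]] Ye Y2 Yind.
have [c c0 /choice[mu muE]] := graph_functional xP n.
pose mon (g : {set {set 'I_n}}) : S n :=
  \prod_(h : hom W 2 n | img h \in g) j n (fm_map V h x).
pose y g : S n := \sum_(w : hom W n n) ga_map S w (mon g).
exists (fun l => i n (y (enum_val l))); split.
- move=> l; apply: igr; apply: grading_sum; first exact: ga_grading.
  move=> w; apply: ga_map_gr; rewrite -(Ye _ (enum_valP l)).
  rewrite -(card_hom_graph (Y2 _ (enum_valP l))).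
  by apply: (ga_gr_prod [pred h : hom W 2 n | img h \in enum_val l]) => h; apply/jgr/gm_map_gr.
- move=> b bE l.
  have {}bE : \sum_l b l *: y (enum_val l) = 0.
    apply: (i_inj n); rewrite linear0 linear_sum -[RHS]bE.
    by apply: eq_bigr => l' _; rewrite linearZ.
  (* H is evaluation at the point [mu g], an algebra morphism to k; it isolates the coefficient of
     [y g]. *)
  pose g := enum_val l; have [H [HE _]] := juniv n k^o (mu g).
  have Hmon (w : hom W n n) g' : H (ga_map S w (mon g')) =
      \prod_(h : hom W 2 n | img h \in g')
        (if ubase w @: img h \in g then c (comph w h) else 0).
    rewrite !rmorph_prod; apply: eq_bigr => h _.
    by rewrite /= -jmap HE -fm_mapM muE img_comp.
  (* Each w takes some edge of g' outside g, and any h over that edge contributes a zero factor. *)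
  have Hy0 g' : g' \in Y -> g' != g -> H (y g') = 0.
    move=> g'Y g'g; rewrite linear_sum big1 // => w _; rewrite /= Hmon.
    have /subsetPn[_ /imsetP[E Eg' ->] wE] := Yind _ _ g'Y (enum_valP l) g'g w.
    have /card_gt0P[h] : (0 < #|[set h : hom W 2 n | img h == E]|)%N.
      by rewrite (card_hom_img W (Y2 _ g'Y _ Eg')); apply/card_gt0P; exists (idh W 2).
    rewrite inE => /eqP hE.
    by rewrite (bigD1 h) /= ?hE // (negPf wE) mul0r.
  (* Only the w that preserve g contribute, each with the same [cg]; their number is nonzero in
     characteristic 0. *)
  have Hyg : H (y g) != 0.
    pose cg := \prod_(h : hom W 2 n | img h \in g) c h.
    have Hw w : H (ga_map S w (mon g)) = if relabel (ubase w) g \subset g then cg else 0.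
      rewrite Hmon; case: ifP => [wg|/negbT/subsetPn[_ /imsetP[E Eg ->] wE]]; last first.
        have /card_gt0P[h] : (0 < #|[set h : hom W 2 n | img h == E]|)%N.
          rewrite (card_hom_img W (Y2 _ (enum_valP l) _ Eg)).
          by apply/card_gt0P; exists (idh W 2).
        rewrite inE => /eqP hE.
        by rewrite (bigD1 h) /= ?hE // (negPf wE) mul0r.
      have wgE : relabel (ubase w) g = g.
        by apply/eqP; rewrite eqEcard wg card_relabel ?leqnn //; apply: ubase_inj.
      rewrite /cg [RHS](reindex_inj (@comph_injr W 2 n n w)).
      have imw (h : hom W 2 n) : (img (comph w h) \in g) = (img h \in g).
        by rewrite img_comp -[in LHS]wgE mem_imset //; apply/imset_inj/ubase_inj.
      apply: eq_big => h; first by rewrite imw.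
      by rewrite -imw img_comp => ->.
    have cg0 : cg != 0 by apply/prodf_neq0 => h _; apply: c0.
    rewrite linear_sum (eq_bigr _ (fun w _ => Hw w)) -big_mkcond sumr_const.
    rewrite -mulr_natr mulf_neq0 // ((pcharf0P k).1 k0) -lt0n.
    apply/card_gt0P; exists (idh W n); rewrite unfold_in /=.
    suff -> : relabel (ubase (idh W n)) g = g by [].
    rewrite -[RHS]relabel_id; apply: eq_imset => E; apply: eq_imset => m.
    exact: ubase_id.
  have /(congr1 H) := bE; rewrite linear0 linear_sum (bigD1 l) //= big1 => [|l' l'l].
    rewrite addr0 linearZ => /eqP; rewrite scaler_eq0 (negPf Hyg) orbF => /eqP //.
  rewrite linearZ /= Hy0 ?scaler0 ?enum_valP //.
  by apply: contraNneq l'l => /enum_val_inj ->.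
- move=> w l; rewrite -imap; congr (i n _).
  rewrite linear_sum [RHS](reindex_inj (@comph_injr W n n n w)).
  by apply: eq_bigr => v _; rewrite ga_mapM.
Qed.

End Monomials.

(** * Divergence of the series *)

Local Open Scope classical_set_scope.

Theorem theorem3p4 (R : realType) (k : fieldType)
    (iota : {rmorphism k -> Cplx R}) (q : nat) (W : wtype)
    (V : gradedFIWmod k W) (A : gradedFIWalg k W)
    (hq : (1 < q)%N)
    (hVpos : positively_graded V)
    (hVfree : contains_free_on V 2)
    (hAfin : finite_type A)
    (hAsym : contains_sym_alg A V) :
  exists P : charpoly k W,
    forall a : nat -> Cplx R,
      (forall d, (fun n : nat => char_inner iota P A n d) @ \oo --> a d) ->
      ~ cvgn (series (fun d : nat => a d / q%:R ^+ d)).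
Proof.
exists (cp_one k W) => a aP.
have [d [x [d0 xd xP]]] := persistent_generator hVpos hVfree.
pose D := (#|{: hom W 2 2}| * d)%N.
have D0 : (0 < D)%N by rewrite muln_gt0 d0 andbT; apply/card_gt0P; exists (idh W 2).
have q0 : (0 < q)%N by apply: ltn_trans hq.
have qC e : 0 < q%:R ^+ e :> Cplx R by rewrite exprn_gt0 // ltr0n.
(* A graph with 2 m edges gives a monomial of degree 2 m D; [bin_edges_ge] is applied with Q = q ^
   (2 D), so that Q ^ m is q to this degree. *)
have large s (m := (4 * s).+1) n : (5 * q ^ (2 * D) <= s)%N -> (m <= n)%N ->
    exists2 N, (q ^ (2 * m * D) <= N)%N &
      char_inner iota (cp_one k W) A n (2 * m * D) = N%:R.
  move=> sq mn; pose M : {set 'I_n} := (widen_ord mn @: [set: 'I_m])%SET.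
  have cM : #|M| = m.
    rewrite card_imset ?cardsT ?card_ord // => i j /(congr1 val) /= ij.
    exact: val_inj.
  have [Y [Ye Y2 Yind cY]] := many_graphs W M (2 * m).
  have [b [bG bfree binv]] :=
    graph_invariants (subfield_pchar0 iota) xP xd hAsym Ye Y2 Yind.
  have [N leN cE] := char_inner_one_ge iota (hAfin n _) bG bfree binv.
  exists N; last by rewrite /D mulnA.
  apply: leq_trans leN; have -> : (2 * m * D = 2 * D * m)%N by rewrite mulnAC.
  rewrite cM in cY; rewrite expnM; apply: bin_edges_ge cY => //.
  by apply: leq_trans sq; rewrite muln_gt0 expn_gt0 q0.
move=> /cvg_series_cvg_0/cvgrPdist_lt/(_ (1 / 2)) [|N0 _ N0P].
  by rewrite divr_gt0 ?ltr0n.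
(* This s meets the bound of [large] and puts e beyond N0, where the terms of a convergent series
   are below 1/2. *)
pose s := maxn (5 * q ^ (2 * D)) N0; pose m := (4 * s).+1; pose e := (2 * m * D)%N.
have := N0P e; rewrite /= sub0r normrN normrM normfV (gtr0_norm (qC e)).
rewrite ltr_pdivrMr // => /(_ _) ae.
have {}ae : `|a e| < 1 / 2 * q%:R ^+ e.
  apply: ae; rewrite (leq_trans (leq_maxr (5 * q ^ (2 * D)) N0)) // -/s /e /m.
  by rewrite -[X in (X <= _)%N]muln1 leq_mul //; lia.
(* For large n the inner product N is within half of q ^ e of its limit [a e], itself below half of
   q ^ e; this contradicts q ^ e <= N. *)
have /cvgrPdist_lt/(_ (1 / 2 * q%:R ^+ e))[] := aP e.
  by rewrite mulr_gt0 // divr_gt0 ?ltr0n.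
move=> N1 _ N1P; have := N1P (maxn N1 m) (leq_maxl _ _).
have [N leN -> /= aN] := large s _ (leq_maxl _ _) (leq_maxr N1 m).
have : `|N%:R : Cplx R| < q%:R ^+ e.
  rewrite -[N%:R](subKr (a e)) (le_lt_trans (ler_normB _ _)) //.
  by rewrite (lt_le_trans (ltrD ae aN)) // -mulrDl -splitr mul1r.
by rewrite normr_nat -natrX ltr_nat ltnNge leN.
Qed.
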